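(* Let $(A,\circ,B(\cdot,\cdot))$ be a quadratic Novikov algebra over $\mathbf{k}$ and $J$ a nonzero isotropic ideal of $(A,\circ)$. Let $A=J^\perp\oplus V$ where $V$ is a subspace of $A$, let $S=J\oplus V$, and let $(W=J^\perp/J,\circ,\bar B(\cdot,\cdot))$ be the quadratic Novikov algebra with the induced product $\bar x\circ\bar y=\overline{x\circ y}$ and the bilinear form $\bar B(\bar x,\bar y)=B(x,y)$ for $x,y\in J^\perp$. Then the quadratic Novikov algebra $(A=V\oplus S^\perp\oplus J,\circ,B(\cdot,\cdot))$ is isomorphic to a double extension of $(W,\circ,\bar B(\cdot,\cdot))$ by a Novikov algebra $(V,\bullet)$ (for some Novikov product $\bullet$ on the vector space $V$) with the symmetric bilinear form $B(\cdot,\cdot)|_{V\times V}$.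
   Context: $\mathbf{k}$ is a field of characteristic zero; all vector spaces and algebras are finite-dimensional over $\mathbf{k}$. A Novikov algebra $(A,\circ)$ is a vector space with a bilinear operation $\circ$ such that $(a\circ b)\circ c-a\circ(b\circ c)=(b\circ a)\circ c-b\circ(a\circ c)$ and $(a\circ b)\circ c=(a\circ c)\circ b$ for all $a,b,c\in A$. Put $a\star b:=a\circ b+b\circ a$. A quadratic Novikov algebra $(A,\circ,B(\cdot,\cdot))$ is a Novikov algebra with a nondegenerate symmetric bilinear form $B:A\times A\to\mathbf{k}$ such that $B(a\circ b,c)=-B(b,a\star c)$ for all $a,b,c\in A$. An isomorphism of quadratic Novikov algebras is a linear bijection preserving the products and the bilinear forms. An ideal $J$ of $(A,\circ)$ is a subspace with $J\circ A\subset J$, $A\circ J\subset J$; it is isotropic if $B(J,J)=0$. For a subspace $U\subset A$, $U^\perp=\{a\in A\mid B(a,b)=0\ \text{for all } b\in U\}$. If $J$ is an isotropic ideal then $J\subset J^\perp$, $J^\perp$ is an ideal, and $J^\perp/J$ with the stated structure is a quadratic Novikov algebra. Double extension: let $(A_1,\circ,B_1(\cdot,\cdot))$ be a quadratic Novikov algebra and $(A_2,\circ)$ a Novikov algebra with a symmetric bilinear form $\tau(\cdot,\cdot)$ (not assumed invariant or nondegenerate). Given linear maps $\mu,\mu':A_2\to\mathrm{End}_{\mathbf{k}}(A_1)$ and bilinear maps $\varphi:A_1\times A_1\to A_2^\ast$, $v:A_2\times A_1\to A_2^\ast$, $v':A_1\times A_2\to A_2^\ast$, $\lambda:A_2\times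 A_2\to A_1$, $\gamma:A_2\times A_2\to A_2^\ast$, define on $A_2\oplus A_1\oplus A_2^\ast$ $$\begin{aligned}(x_2+x_1+f)\cdot(y_2+y_1+g)=\;&x_2\circ y_2+\lambda(x_2,y_2)+\gamma(x_2,y_2)+x_1\circ y_1+\varphi(x_1,y_1)+\mu(x_2)(y_1)\\&+v(x_2,y_1)+L_\star^\ast(x_2)g+\mu'(y_2)(x_1)+v'(x_1,y_2)-R_\circ^\ast(y_2)f,\\ B(x_2+x_1+f,\,y_2+y_1+g)=\;&\tau(x_2,y_2)+B_1(x_1,y_1)+f(y_2)+g(x_2),\end{aligned}$$ where $(L_\star^\ast(x)f)(z)=-f(x\circ z+z\circ x)$ and $(R_\circ^\ast(y)f)(z)=-f(z\circ y)$ for $x,y,z\in A_2$, $f\in A_2^\ast$. Whenever $(A_2\oplus A_1\oplus A_2^\ast,\cdot,B(\cdot,\cdot))$ is a quadratic Novikov algebra, it is called a double extension of $(A_1,\circ,B_1(\cdot,\cdot))$ by the Novikov algebra $(A_2,\circ)$ with the symmetric bilinear form $\tau(\cdot,\cdot)$. *)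

(* Defs.v *)
From HB Require Import structures.
From mathcomp Require Import all_boot all_order all_algebra.

Set Implicit Arguments.
Unset Strict Implicit.
Unset Printing Implicit Defensive.

Import GRing.Theory.
Local Open Scope ring_scope.
Local Open Scope quotient_scope.

(* The quotient of a finite-dimensional vector space by a subspace: the type  *)
(* of cosets from ring_quotient, with the induced vector space structure.     *)
Section QuotientSpace.

Import VectorInternalTheory.

Variables (k : fieldType) (T : vectType k) (K : {vspace T}).

Definition quotv : Type := Quotient.quot K.

HB.instance Definition _ := Choice.on quotv.
HB.instance Definition _ := EqQuotient.on quotv.
HB.instance Definition _ := GRing.Zmodule.on quotv.
HB.instance Definition _ := ZmodQuotient.on quotv.

Lemma quotv_eq (x y : T) : (\pi_quotv x == \pi_quotv y) = (x - y \in K).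
Proof. by rewrite -[LHS]/(x == y %[mod Quotient.quot K]) -Quotient.idealrBE. Qed.

Lemma quotv_reprB (x : T) : repr (\pi_quotv x) - x \in K.
Proof. by rewrite -quotv_eq reprK. Qed.

Lemma quotv_piD : {morph \pi_quotv : x y / x + y >-> x + y}.
Proof. exact: (@pi_addr _ _ _ _ _ quotv). Qed.

Definition quotv_scale (c : k) (q : quotv) : quotv := \pi_quotv (c *: repr q).

Lemma quotv_piZ c : {morph \pi_quotv : x / c *: x >-> quotv_scale c x}.
Proof.
move=> x; apply/eqP; rewrite eq_sym quotv_eq -scalerBr.
exact: memvZ (quotv_reprB _).
Qed.

Fact quotv_scaleA a b q :
  quotv_scale a (quotv_scale b q) = quotv_scale (a * b) q.
Proof. by elim/quotW: q => x; rewrite -(quotv_piZ b) -!quotv_piZ scalerA. Qed.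

Fact quotv_scale1 : left_id 1 quotv_scale.
Proof. by elim/quotW=> x; rewrite -quotv_piZ scale1r. Qed.

Fact quotv_scaleDr : right_distributive quotv_scale +%R.
Proof.
move=> a; elim/quotW=> x; elim/quotW=> y.
by rewrite -quotv_piD -!quotv_piZ -quotv_piD scalerDr.
Qed.

Fact quotv_scaleDl q : {morph quotv_scale^~ q : a b / a + b}.
Proof.
move=> a b /=; elim/quotW: q => x; rewrite -!quotv_piZ -quotv_piD.
by rewrite scalerDl.
Qed.

HB.instance Definition _ := GRing.Zmodule_isLmodule.Build k quotv
  quotv_scaleA quotv_scale1 quotv_scaleDr quotv_scaleDl.

Lemma quotv_pi_linear : linear (\pi_quotv : T -> quotv).
Proof. by move=> c x y; rewrite quotv_piD quotv_piZ. Qed.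

Let coords (q : quotv) := v2r (vsproj K^C (daddv_pi K^C K (repr q))).

Let cKK : (K^C :&: K = 0)%VS.
Proof. by rewrite capvC capv_compl. Qed.

Let daddK x : x \in K -> daddv_pi K^C K x = 0.
Proof.
move=> Kx; have := daddv_pi_add cKK (_ : x \in (K^C + K)%VS).
rewrite addvC addv_complf memvf => /(_ isT).
by rewrite (daddv_pi_id (capv_compl K)) // -[RHS]add0r => /addIr.
Qed.

Let coords_pi x : coords (\pi_quotv x) = v2r (vsproj K^C (daddv_pi K^C K x)).
Proof.
rewrite /coords -[repr _](subrK x) raddfD /= daddK ?quotv_reprB //.
by rewrite add0r.
Qed.

Fact quotv_vect_axiom : Vector.axiom (dim (subvs_of K^C)) quotv.
Proof.
exists coords.
  move=> c; elim/quotW=> x; elim/quotW=> y.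
  by rewrite -quotv_pi_linear !coords_pi !linearP.
exists (fun r => \pi_quotv (vsval (r2v r : subvs_of K^C))) => [q|r].
  elim/quotW: q => x; rewrite coords_pi v2rK vsprojK ?memv_pi //.
  apply/eqP; rewrite quotv_eq.
  have := daddv_pi_add cKK (_ : x \in (K^C + K)%VS).
  rewrite addvC addv_complf memvf => /(_ isT) E; rewrite -{2}E.
  by rewrite opprD addNKr rpredN memv_pi.
rewrite coords_pi daddv_pi_id ?subvsP //.
by rewrite vsvalK r2vK.
Qed.

HB.instance Definition _ := Lmodule_hasFinDim.Build k quotv quotv_vect_axiom.

End QuotientSpace.

Lemma linfun_linearE (k : fieldType) (U V : vectType k) (g : U -> V) x :
  linear g -> linfun g x = g x.
Proof.
move=> lin; pose L := GRing.isLinear.Build _ _ _ _ g lin.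
pose f : {linear U -> V} := HB.pack g L.
exact: (lfunE f x).
Qed.

Section QuadraticNovikov.

Variables (k : fieldType) (A : vectType k).
Implicit Types (mul : {bilinear A -> A -> A}) (B : {symmetric A}).

Definition novikov mul : Prop :=
  (forall a b c, mul (mul a b) c - mul a (mul b c)
                 = mul (mul b a) c - mul b (mul a c))
  /\ (forall a b c, mul (mul a b) c = mul (mul a c) b).

Definition star mul (a b : A) : A := mul a b + mul b a.

Definition quadratic_novikov mul B : Prop :=
  [/\ novikov mul,
      nondegenerate B
    & forall a b c, B (mul a b) c = - B b (star mul a c)].

Definition ideal mul (J : {vspace A}) : Prop :=
  forall x a, x \in J -> mul x a \in J /\ mul a x \in J.

Definition isotropic B (J : {vspace A}) : Prop :=
  {in J & J, forall x y, B x y = 0}.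

End QuadraticNovikov.

Definition quadratic_novikov_iso (k : fieldType) (A A' : vectType k)
    (mul : {bilinear A -> A -> A}) (B : {symmetric A})
    (mul' : {bilinear A' -> A' -> A'}) (B' : {symmetric A'}) : Prop :=
  exists f : 'Hom(A, A'),
    [/\ bijective f,
        {morph f : a b / mul a b >-> mul' a b}
      & isometry B' B f].

Section RestrictedForm.

Variables (k : fieldType) (A : vectType k) (B : {symmetric A}).
Variable V : {vspace A}.

Definition res_form (x y : subvs_of V) : k := B (vsval x) (vsval y).

Fact res_form_bilinear : bilinear_for *%R (idfun \; *%R) res_form.
Proof.
by split=> y c x x'; rewrite /res_form linearP ?linearPl ?linearPr.
Qed.

HB.instance Definition _ := bilinear_isBilinear.Build k _ _ k *%R
  (idfun \; *%R) res_form res_form_bilinear.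

Fact res_form_sym x y : res_form x y = (-1) ^+ false * idfun (res_form y x).
Proof. exact: hermC. Qed.

HB.instance Definition _ := isHermitianSesquilinear.Build k (subvs_of V)
  false idfun res_form res_form_sym.

End RestrictedForm.

Arguments res_form {k A} B V x y.

(* The quotient W = J^perp / J: J is seen as a subspace of the vector space   *)
(* J^perp by taking its preimage under the inclusion J^perp -> A.             *)
Section IsotropicReduction.

Variables (k : fieldType) (A : vectType k).
Variables (mul : {bilinear A -> A -> A}) (B : {symmetric A}) (J : {vspace A}).

Let P : {vspace A} := orthov B J.

Definition redv : vectType k :=
  quotv (linfun (vsval : subvs_of P -> A) @^-1: J)%VS.

Definition red_pi (x : subvs_of P) : redv :=
  \pi_(quotv (linfun (vsval : subvs_of P -> A) @^-1: J)%VS) x.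

Definition red_repr (w : redv) : subvs_of P :=
  repr (w : quotv (linfun (vsval : subvs_of P -> A) @^-1: J)%VS).

Lemma red_pi_linear : linear red_pi.
Proof. exact: quotv_pi_linear. Qed.

HB.instance Definition _ := GRing.isLinear.Build k _ _ _ red_pi red_pi_linear.

Lemma red_reprK w : red_pi (red_repr w) = w.
Proof. exact: reprK. Qed.

Lemma red_pi_eq x y : (red_pi x == red_pi y) = (vsval x - vsval y \in J).
Proof. by rewrite [LHS]quotv_eq -memv_preim lfunE. Qed.

Lemma red_reprB x : vsval (red_repr (red_pi x)) - vsval x \in J.
Proof. by rewrite -red_pi_eq red_reprK. Qed.

Hypotheses (AB : quadratic_novikov mul B).
Hypotheses (idJ : ideal mul J) (isoJ : isotropic B J).

Lemma isotropic_sub_orthov : (J <= orthov B J)%VS.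
Proof. by apply/subvP=> x Jx; apply/mem_orthovP => y; apply: isoJ. Qed.

Let symB x y : B x y = B y x.
Proof. by rewrite hermC expr0 mul1r. Qed.

Lemma ideal_orthov : ideal mul (orthov B J).
Proof.
have [_ _ inv] := AB.
have Rself a b c : B (mul a b) c = B (mul c b) a.
  by rewrite !inv /star addrC.
move=> x a /mem_orthovP Px; split; apply/mem_orthovP => y Jy.
  by rewrite Rself symB Px //; case: (idJ a Jy).
rewrite inv Px ?oppr0 //.
by rewrite /star memvD //; case: (idJ a Jy).
Qed.

(* The product and the form of W are computed on representatives; red_mulE    *)
(* and red_formE show that they are the ones induced by those of A.           *)
Definition red_mul_op (w w' : redv) : redv :=
  red_pi (vsproj P (mul (vsval (red_repr w)) (vsval (red_repr w')))).

Definition red_form_op (w w' : redv) : k :=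
  B (vsval (red_repr w)) (vsval (red_repr w')).

Lemma red_mul_opE (x y : subvs_of P) :
  red_mul_op (red_pi x) (red_pi y)
  = red_pi (vsproj P (mul (vsval x) (vsval y))).
Proof.
apply/eqP; rewrite red_pi_eq.
have Pmul (u v : subvs_of P) : mul (vsval u) (vsval v) \in P.
  by have [] := ideal_orthov (vsval v) (subvsP u).
rewrite !vsprojK ?Pmul //; move: (red_reprB x) (red_reprB y).
set x' := vsval (red_repr _); set y' := vsval (red_repr _) => Jx Jy.
have -> : mul x' y' - mul (vsval x) (vsval y)
        = mul (x' - vsval x) y' + mul (vsval x) (y' - vsval y).
  by rewrite linearBl linearBr addrA subrK.
by rewrite memvD //; [case: (idJ y' Jx) | case: (idJ (vsval x) Jy)].
Qed.

Lemma red_form_opE (x y : subvs_of P) :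
  red_form_op (red_pi x) (red_pi y) = B (vsval x) (vsval y).
Proof.
rewrite /red_form_op; move: (red_reprB x) (red_reprB y).
have /mem_orthovP Py' := subvsP (red_repr (red_pi y)).
have /mem_orthovP Px := subvsP x.
set x' := vsval (red_repr _); set y' := vsval (red_repr _) in Py' *.
move=> Jx Jy.
have E1 : B y' x' = B y' (vsval x).
  by apply/eqP; rewrite -subr_eq0 -[_ - _](linearBr B); apply/eqP/Py'.
have E2 : B (vsval x) y' = B (vsval x) (vsval y).
  by apply/eqP; rewrite -subr_eq0 -[_ - _](linearBr B); apply/eqP/Px.
by rewrite symB E1 symB E2.
Qed.

Fact red_mul_bilinear : bilinear_for *:%R *:%R red_mul_op.
Proof.
split=> w c u v; rewrite -[w]red_reprK -[u]red_reprK -[v]red_reprK.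
  by rewrite -linearP !red_mul_opE linearP linearPl !linearP.
by rewrite -linearP !red_mul_opE !linearP.
Qed.

Fact red_form_bilinear : bilinear_for *%R (idfun \; *%R) red_form_op.
Proof.
split=> w c u v; rewrite -[w]red_reprK -[u]red_reprK -[v]red_reprK.
  by rewrite -linearP !red_form_opE linearP linearPl.
by rewrite -linearP !red_form_opE !linearP.
Qed.

Fact red_form_sym w w' :
  red_form_op w w' = (-1) ^+ false * idfun (red_form_op w' w).
Proof. exact: hermC. Qed.

Definition red_mul : {bilinear redv -> redv -> redv} :=
  HB.pack red_mul_op (bilinear_isBilinear.Build k redv redv redv *:%R *:%R
                        red_mul_op red_mul_bilinear).

Definition red_form : {symmetric redv} :=
  HB.pack red_form_op
    (bilinear_isBilinear.Build k redv redv k *%R (idfun \; *%R)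
       red_form_op red_form_bilinear)
    (isHermitianSesquilinear.Build k redv false idfun red_form_op red_form_sym).

Lemma red_mulE (x y z : subvs_of P) :
  vsval z = mul (vsval x) (vsval y) -> red_mul (red_pi x) (red_pi y) = red_pi z.
Proof. by move=> Ez; rewrite [LHS]red_mul_opE -Ez vsvalK. Qed.

Lemma red_formE (x y : subvs_of P) :
  red_form (red_pi x) (red_pi y) = B (vsval x) (vsval y).
Proof. exact: red_form_opE. Qed.

End IsotropicReduction.

Section DoubleExtension.

Variable k : fieldType.

Local Notation dual T := 'Hom(T, k^o).

Section Dual.

Variables (T : vectType k) (mul : {bilinear T -> T -> T}).

(* (L_star^*(x) f)(z) = - f (x o z + z o x) and (R_o^*(y) f)(z) = - f (z o y) *)
Definition dualLstar (x : T) (f : dual T) : dual T :=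
  linfun (fun z => - f (star mul x z)).

Definition dualR (y : T) (f : dual T) : dual T :=
  linfun (fun z => - f (mul z y)).

Lemma dualLstarE x f z : dualLstar x f z = - f (star mul x z).
Proof.
apply: (linfun_linearE (V := k^o)) => c u v.
rewrite /star linearPl linearPr addrACA -scalerDr linearP opprD.
by rewrite scalerN.
Qed.

Lemma dualRE y f z : dualR y f z = - f (mul z y).
Proof.
apply: (linfun_linearE (V := k^o)) => c u v.
by rewrite linearPl linearP opprD scalerN.
Qed.

Fact dualLstar_bilinear : bilinear_for *:%R *:%R dualLstar.
Proof.
split=> u c v w; apply/lfunP=> z; rewrite add_lfunE scale_lfunE !dualLstarE.
  rewrite /star linearPl linearPr addrACA -scalerDr linearP opprD.
  by rewrite scalerN.
by rewrite add_lfunE scale_lfunE opprD scalerN.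
Qed.

HB.instance Definition _ := bilinear_isBilinear.Build k _ _ _ *:%R *:%R
  dualLstar dualLstar_bilinear.

Fact dualR_bilinear : bilinear_for *:%R *:%R dualR.
Proof.
split=> u c v w; apply/lfunP=> z; rewrite add_lfunE scale_lfunE !dualRE.
  by rewrite linearPr linearP opprD scalerN.
by rewrite add_lfunE scale_lfunE opprD scalerN.
Qed.

HB.instance Definition _ := bilinear_isBilinear.Build k _ _ _ *:%R *:%R
  dualR dualR_bilinear.

End Dual.

Record dext_data (A1 A2 : vectType k) := DextData {
  dext_mu : 'Hom(A2, 'End(A1));
  dext_mu' : 'Hom(A2, 'End(A1));
  dext_phi : {bilinear A1 -> A1 -> dual A2};
  dext_v : {bilinear A2 -> A1 -> dual A2};
  dext_v' : {bilinear A1 -> A2 -> dual A2};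
  dext_lambda : {bilinear A2 -> A2 -> A1};
  dext_gamma : {bilinear A2 -> A2 -> dual A2} }.

(* The carrier A2 (+) A1 (+) A2^*, where (x2, x1, f) stands for x2 + x1 + f. *)
Definition dext (A1 A2 : vectType k) : vectType k := (A2 * A1 * dual A2)%type.

Section Operations.

Variables (A1 A2 : vectType k).
Variables (mul1 : {bilinear A1 -> A1 -> A1}) (B1 : {symmetric A1}).
Variables (mul2 : {bilinear A2 -> A2 -> A2}) (tau : {symmetric A2}).
Variable D : dext_data A1 A2.

Definition dext_mul (X Y : dext A1 A2) : dext A1 A2 :=
  let: (x2, x1, f) := X in
  let: (y2, y1, g) := Y in
  ( mul2 x2 y2,
    dext_lambda D x2 y2 + mul1 x1 y1 + dext_mu D x2 y1 + dext_mu' D y2 x1,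
    dext_gamma D x2 y2 + dext_phi D x1 y1 + dext_v D x2 y1
      + dualLstar mul2 x2 g + dext_v' D x1 y2 - dualR mul2 y2 f ).

Definition dext_form (X Y : dext A1 A2) : k :=
  let: (x2, x1, f) := X in
  let: (y2, y1, g) := Y in
  tau x2 y2 + B1 x1 y1 + f y2 + g x2.

Fact dext_mul_bilinear : bilinear_for *:%R *:%R dext_mul.
Proof.
have L (V : lmodType k) (c : k) (a b a' b' : V) :
  c *: (a + b) + (a' + b') = (c *: a + a') + (c *: b + b').
  by rewrite scalerDr addrACA.
split=> -[[z2 z1] h] c [[x2 x1] f] [[y2 y1] g].
  congr (_, _, _); rewrite /= ?L.
  - by rewrite linearPl.
  - by rewrite !linearPl !linearP add_lfunE scale_lfunE.
  - by rewrite !linearPl linearPr scalerN -opprD.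
congr (_, _, _); rewrite /= ?L.
- by rewrite linearPr.
- by rewrite !linearPr !linearP add_lfunE scale_lfunE.
- by rewrite !linearPr linearPl scalerN -opprD.
Qed.

HB.instance Definition _ := bilinear_isBilinear.Build k _ _ _ *:%R *:%R
  dext_mul dext_mul_bilinear.

Fact dext_form_bilinear : bilinear_for *%R (idfun \; *%R) dext_form.
Proof.
have L (c a b a' b' : k) : c * (a + b) + (a' + b') = (c * a + a') + (c * b + b').
  by rewrite mulrDr addrACA.
split=> -[[z2 z1] h] c [[x2 x1] f] [[y2 y1] g] /=.
  by rewrite !L !linearPl linearP add_lfunE scale_lfunE.
by rewrite !L !linearPr linearP add_lfunE scale_lfunE.
Qed.

HB.instance Definition _ := bilinear_isBilinear.Build k _ _ k *%R
  (idfun \; *%R) dext_form dext_form_bilinear.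

Fact dext_form_sym X Y : dext_form X Y = (-1) ^+ false * idfun (dext_form Y X).
Proof.
case: X Y => [[x2 x1] f] [[y2 y1] g] /=; rewrite expr0 mul1r addrAC.
by rewrite (hermC tau) (hermC B1) !expr0 !mul1r.
Qed.

HB.instance Definition _ := isHermitianSesquilinear.Build k (dext A1 A2)
  false idfun dext_form dext_form_sym.

Definition double_extension : Prop :=
  [/\ quadratic_novikov mul1 B1,
      novikov mul2
    & quadratic_novikov dext_mul dext_form].

End Operations.

End DoubleExtension.

(* Main.v *)
(* Write P = J^perp and let p be the projection of A onto V along P. The      *)
(* isomorphism sends a to (p a, class of a - p a in P/J, B(a - p a, -)|V).    *)
(* It is an isometry because P is orthogonal to J, hence injective; it is     *)
(* onto because B identifies J with V^*. The structure maps of the double     *)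
(* extension are read off the transported product, and the remaining terms    *)
(* agree because J annihilates P on both sides, while invariance of B turns   *)
(* the products of V and J into L_star^* and -R_o^*.                          *)

From HB Require Import structures.
Require Import Defs.
From mathcomp Require Import all_boot all_order all_algebra.

Set Implicit Arguments.
Unset Strict Implicit.
Unset Printing Implicit Defensive.

Import GRing.Theory.
Local Open Scope ring_scope.

(** Nondegeneracy of [B] gives J ∩ V^⊥ = 0, and V ∩ J^⊥ = 0 by hypothesis, so [B] pairs J and V
    perfectly: J is a copy of V^*. Hence S = J + V is nondegenerate, A = S ⊕ S^⊥, and S^⊥ is a copy
    of J^⊥/J; this makes the isometry [decomp] a bijection.

    For the product, invariance makes right multiplications self-adjoint ([form_mulC]) and forces
    J^⊥ and J to annihilate each other ([mul_orthov_ideal]). Of the nine blocks of the product on V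
    ⊕ S^⊥ ⊕ J, three therefore vanish. The four blocks without a factor in J supply the products on
    V and W and the structure maps; the blocks V·J and J·V are dictated by invariance
    ([part_dual_mull], [part_dual_mulr]). Thus [decomp] is multiplicative ([decomp_mul]).

    The axioms of the extension are transported along [decomp], and the Novikov identities on V are
    their V-coordinates. *)

(** * Orthogonal complements and dimension bounds *)

Section Orthogonality.

Variables (k : fieldType) (A : vectType k) (B : {symmetric A}).
Implicit Types U V : {vspace A}.

Lemma symmetric_formC x y : B x y = B y x.
Proof. by rewrite hermC expr0 mul1r. Qed.

Lemma nondegenerateP :
  reflect (forall x, (forall y, B x y = 0) -> x = 0) (nondegenerate B).
Proof.
apply: (iffP eqP) => [rad0 x Bx | Binj].
  by apply/eqP; rewrite -memv0 -rad0; apply/mem_orthovP => y _.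
apply/eqP; rewrite -subv0; apply/subvP => x /mem_orthovP Bx.
by rewrite memv0; apply/eqP/Binj => y; rewrite Bx ?memvf.
Qed.

Definition res_functional U (x : A) : 'Hom(subvs_of U, k^o) :=
  linfun (fun u : subvs_of U => B x (vsval u) : k^o).

Lemma res_functionalE U x u : res_functional U x u = B x (vsval u).
Proof.
by apply: (linfun_linearE (V := k^o)) => c v w; rewrite !linearP.
Qed.

Fact res_functional_linear U : linear (res_functional U).
Proof.
move=> c x y; apply/lfunP => u.
by rewrite add_lfunE scale_lfunE !res_functionalE linearPl.
Qed.

HB.instance Definition _ U :=
  GRing.isLinear.Build k A 'Hom(subvs_of U, k^o) *:%R (res_functional U)
    (res_functional_linear U).

Lemma lker_res_functional U : lker (linfun (res_functional U)) = orthov B U.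
Proof.
apply/vspaceP => x; rewrite memv_ker lfunE /=.
apply/eqP/mem_orthovP => [Bx0 y Uy | Bx0].
  by rewrite -(vsprojK Uy) -res_functionalE Bx0 lfunE.
by apply/lfunP => u; rewrite res_functionalE lfunE Bx0 ?subvsP.
Qed.

Lemma dim_dual U : \dim {: 'Hom(subvs_of U, k^o)} = \dim U.
Proof. by rewrite dimvf; exact: muln1. Qed.

(** U^⊥ is the kernel of the map from A to U^* given by [B], so its codimension is at most dim U. *)
Lemma dim_orthov_geq U : (\dim {: A} <= \dim U + \dim (orthov B U))%N.
Proof.
rewrite -(limg_ker_dim (linfun (res_functional U)) fullv) capfv.
by rewrite lker_res_functional addnC leq_add2r -dim_dual dimvS ?subvf.
Qed.

(** U embeds in A/V^⊥, whose dimension is at most dim V. *)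
Lemma leq_dim_pairing U V :
  (U :&: orthov B V = 0)%VS -> (\dim U <= \dim V)%N.
Proof.
move=> UV0; rewrite -(leq_add2r (\dim (orthov B V))).
by rewrite -dimv_disjoint_sum // (leq_trans _ (dim_orthov_geq V)) ?dimvS ?subvf.
Qed.

Lemma addv_orthov U : (U :&: orthov B U = 0)%VS -> (U + orthov B U)%VS = fullv.
Proof.
move=> UU0; apply/eqP; rewrite eqEdim subvf dimv_disjoint_sum //.
exact: dim_orthov_geq.
Qed.

Lemma orthov_orthov U : nondegenerate B -> orthov B (orthov B U) = U.
Proof.
move=> /nondegenerateP ndB; set P := orthov B U.
apply/esym/eqP; rewrite eqEdim orthov_sym subvv /=.
(* A vector of P^⊥ that is also orthogonal to a complement of P lies in the radical, so P^⊥ pairs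
   injectively with that complement, whose dimension is at most dim U. *)
apply: (@leq_trans (\dim P^C)).
  apply: leq_dim_pairing; apply/eqP; rewrite -subv0; apply/subvP => x.
  rewrite memv_cap memv0 => /andP[/mem_orthovP Px /mem_orthovP Cx].
  apply/eqP/ndB => y; have: y \in (P + P^C)%VS by rewrite addv_complf memvf.
  by case/memv_addP=> p Pp [c Cc ->]; rewrite linearDr /= Px ?Cx ?addr0.
by rewrite dimv_compl leq_subLR addnC dim_orthov_geq.
Qed.

End Orthogonality.

(** * Transport of structure, orthogonals of ideals, and the reduction J^⊥/J *)

Lemma quadratic_novikov_transport (k : fieldType) (A A' : vectType k)
    (mul : {bilinear A -> A -> A}) (B : {symmetric A})
    (mul' : {bilinear A' -> A' -> A'}) (B' : {symmetric A'}) :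
  quadratic_novikov_iso mul B mul' B' ->
  quadratic_novikov mul B -> quadratic_novikov mul' B'.
Proof.
case=> f [[g fK gK] fM fB] [[ls rc] /nondegenerateP ndB inv].
split; first split.
- move=> a b c; rewrite -[a]gK -[b]gK -[c]gK -!fM -!linearB.
  by rewrite ls.
- by move=> a b c; rewrite -[a]gK -[b]gK -[c]gK -!fM rc.
- apply/nondegenerateP => x Bx; rewrite -[x]gK (ndB (g x)) ?linear0 // => y.
  by rewrite -fB gK.
move=> a b c; rewrite -[a]gK -[b]gK -[c]gK /star -!fM -linearD !fB.
exact: inv.
Qed.

Section OrthogonalIdeal.

Variables (k : fieldType) (A : vectType k).
Variables (mul : {bilinear A -> A -> A}) (B : {symmetric A}).
Hypothesis AB : quadratic_novikov mul B.

Lemma form_mulC a b c : B (mul a b) c = B (mul c b) a.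
Proof. by have [_ _ inv] := AB; rewrite !inv /star addrC. Qed.

Variable J : {vspace A}.
Hypothesis idJ : ideal mul J.

(** Pairing either product with any a moves the multiplication onto p; the result stays in the ideal
    J^⊥ and so is orthogonal to j. Nondegeneracy concludes. *)
Lemma mul_orthov_ideal p j : p \in orthov B J -> j \in J ->
  mul p j = 0 /\ mul j p = 0.
Proof.
have [_ /nondegenerateP ndB inv] := AB.
have idP := ideal_orthov AB idJ.
move=> Pp Jj; split; apply: ndB => a.
  have [pa ap] := idP _ a Pp; rewrite inv /star symmetric_formC.
  have /mem_orthovP -> // := memvD pa ap.
  by rewrite oppr0.
rewrite form_mulC; have [_ /mem_orthovP-> //] := idP _ a Pp.
Qed.

End OrthogonalIdeal.

Lemma quadratic_novikov_red (k : fieldType) (A : vectType k)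
    (mul : {bilinear A -> A -> A}) (B : {symmetric A}) (J : {vspace A})
    (AB : quadratic_novikov mul B) (idJ : ideal mul J) :
  quadratic_novikov (red_mul AB idJ) (red_form B J).
Proof.
have [[ls rc] ndB inv] := AB.
have idP := ideal_orthov AB idJ; set P := orthov B J in idP *.
have PM (x y : subvs_of P) :
    mul (vsval x) (vsval y) = vsval (vsproj P (mul (vsval x) (vsval y))).
  by rewrite vsprojK //; case: (idP _ (vsval y) (subvsP x)).
have redM (x y : subvs_of P) : red_mul AB idJ (red_pi x) (red_pi y)
    = red_pi (vsproj P (mul (vsval x) (vsval y))) by exact: red_mul_opE.
split; first split.
- move=> a b c; rewrite -[a]red_reprK -[b]red_reprK -[c]red_reprK.
  have redB (u v : A) : red_pi (vsproj P u) - red_pi (vsproj P v)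
      = red_pi (vsproj P (u - v)) :> redv B J.
    by rewrite [vsproj P (u - v)]raddfB [RHS]raddfB.
  by rewrite !redM -!PM !redB ls.
- move=> a b c; rewrite -[a]red_reprK -[b]red_reprK -[c]red_reprK.
  by rewrite !redM -!PM rc.
- apply/nondegenerateP => a; rewrite -[a]red_reprK => Ba.
  have <- : red_pi (0 : subvs_of P) = 0 by exact: linear0.
  apply/eqP; rewrite red_pi_eq /= subr0.
  (* The radical of the form on J^⊥/J comes from J^⊥⊥, which is J. *)
  have /vspaceP <- := orthov_orthov J ndB; apply/mem_orthovP => y Py.
  by rewrite -(vsprojK Py) -red_formE Ba.
move=> a b c; rewrite -[a]red_reprK -[b]red_reprK -[c]red_reprK.
have redS (x y : subvs_of P) : star (red_mul AB idJ) (red_pi x) (red_pi y)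
    = red_pi (vsproj P (star mul (vsval x) (vsval y))).
  by rewrite /star !redM !raddfD.
rewrite redM redS !red_formE -PM vsprojK; first exact: inv.
by rewrite memvD // PM subvsP.
Qed.

(** * Building blocks for the structure maps *)

Section BilinearComposition.

Variables (k : fieldType) (A U V W : vectType k).
Variables (mul : {bilinear A -> A -> A}).
Variables (h : 'Hom(A, W)) (i : 'Hom(U, A)) (j : 'Hom(V, A)).

(** The product on V and all structure maps of the extension are blocks of this shape: embed two
    summands, multiply in A, project to a third. *)
Definition bilinear_comp (u : U) (v : V) : W := h (mul (i u) (j v)).

Fact bilinear_comp_bilinear : bilinear_for *:%R *:%R bilinear_comp.
Proof.
split=> w c x y; rewrite /bilinear_comp.
  by rewrite linearP linearPl linearP.
by rewrite linearP linearPr linearP.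
Qed.

HB.instance Definition _ := bilinear_isBilinear.Build k U V W *:%R *:%R
  bilinear_comp bilinear_comp_bilinear.

End BilinearComposition.

Section CurriedHom.

Variables (k : fieldType) (U V W : vectType k).
Implicit Type m : {bilinear U -> V -> W}.

Definition hom_of_bilinearl m : 'Hom(U, 'Hom(V, W)) :=
  linfun (fun u => linfun (m u)).

Definition hom_of_bilinearr m : 'Hom(V, 'Hom(U, W)) :=
  linfun (fun v => linfun (m^~ v)).

Let linl m v : linear (m^~ v). Proof. by move=> c x y; rewrite linearPl. Qed.

Let linr m u : linear (m u). Proof. by move=> c x y; rewrite linearPr. Qed.

Lemma hom_of_bilinearlE m u v : hom_of_bilinearl m u v = m u v.
Proof.
rewrite linfun_linearE ?linfun_linearE // => c x y; apply/lfunP => w.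
by rewrite add_lfunE scale_lfunE !linfun_linearE // linl.
Qed.

Lemma hom_of_bilinearrE m u v : hom_of_bilinearr m v u = m u v.
Proof.
rewrite linfun_linearE ?linfun_linearE // => c x y; apply/lfunP => w.
by rewrite add_lfunE scale_lfunE !linfun_linearE // linr.
Qed.

End CurriedHom.

(** * The splitting of A into V, S^⊥ and J *)

Section Decomposition.

Variables (k : fieldType) (A : vectType k).
Variables (mul : {bilinear A -> A -> A}) (B : {symmetric A}).
Hypothesis AB : quadratic_novikov mul B.
Variable J : {vspace A}.
Hypotheses (idJ : ideal mul J) (isoJ : isotropic B J).
Variable V : {vspace A}.
Let P := orthov B J.
Hypotheses (PV0 : (P :&: V = 0)%VS) (PVf : (P + V)%VS = fullv).

Let ndB : nondegenerate B. Proof. by case: AB. Qed.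

Let JP : (J <= P)%VS := isotropic_sub_orthov isoJ.

Let VP0 : (V :&: P = 0)%VS. Proof. by rewrite capvC. Qed.

Lemma cap_isotropic_orthov : (J :&: orthov B V = 0)%VS.
Proof.
apply/eqP; rewrite -subv0; apply/subvP => j.
rewrite memv_cap memv0 => /andP[Jj /mem_orthovP Vj].
apply/eqP/(nondegenerateP _ ndB) => y.
have: y \in (P + V)%VS by rewrite PVf memvf.
case/memv_addP=> p /mem_orthovP Pp [v Vv ->].
by rewrite linearDr /= (Vj v Vv) symmetric_formC Pp ?addr0.
Qed.

(** Neither J nor V contains a nonzero vector orthogonal to the other, so each embeds in the dual of
    the other. *)
Lemma dim_isotropic_compl : \dim J = \dim V.
Proof.
apply/eqP; rewrite eqn_leq.
by rewrite (leq_dim_pairing cap_isotropic_orthov) (leq_dim_pairing VP0).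
Qed.

Lemma directv_isotropic_compl : directv (J + V).
Proof.
apply/directv_addP/eqP; rewrite -subv0 -PV0.
by rewrite subv_cap capvSr andbT (subv_trans (capvSl _ _) JP).
Qed.

(** For j + v orthogonal to J + V, pairing with J puts v in J^⊥ and so kills it; pairing with V then
    kills j. *)
Lemma cap_hyperbolic_orthov : ((J + V) :&: orthov B (J + V) = 0)%VS.
Proof.
apply/eqP; rewrite -subv0; apply/subvP => x.
rewrite memv_cap => /andP[/memv_addP[j Jj [v Vv ->]] /mem_orthovP JVx].
have Jv : v \in P.
  apply/mem_orthovP => y Jy; have := JVx y (subvP (addvSl _ _) _ Jy).
  by rewrite linearDl /= isoJ // add0r.
have v0 : v = 0 by apply/eqP; rewrite -memv0 -PV0 memv_cap Jv.
rewrite -cap_isotropic_orthov memv_cap v0 addr0 Jj; apply/mem_orthovP => y Vy.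
by have := JVx y (subvP (addvSr _ _) _ Vy); rewrite v0 addr0.
Qed.

Lemma addv_hyperbolic : (V + orthov B (J + V) + J)%VS = fullv.
Proof.
by rewrite addvC addvA (addv_orthov cap_hyperbolic_orthov).
Qed.

Lemma directv_hyperbolic : directv (V + orthov B (J + V) + J).
Proof.
have E := addv_orthov cap_hyperbolic_orthov.
rewrite directvE /= addv_hyperbolic -E.
rewrite dimv_disjoint_sum ?cap_hyperbolic_orthov // dimv_disjoint_sum.
  by rewrite [eqbRHS]addnC addnA.
exact/directv_addP/directv_isotropic_compl.
Qed.

(** * The coordinate map and its bijectivity *)

Definition part_compl : 'Hom(A, subvs_of V) :=
  (linfun (@vsproj _ _ V) \o daddv_pi V P)%VF.

Definition part_red : 'Hom(A, redv B J) :=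
  (linfun (@red_pi _ _ B J) \o linfun (@vsproj _ _ P) \o daddv_pi P V)%VF.

(* The functional part_dual a is taken on the whole P-component of a, not on  *)
(* its J-component for the decomposition V + S^perp + J: the two agree, as    *)
(* S^perp is orthogonal to V.                                                 *)
Definition part_dual : 'Hom(A, 'Hom(subvs_of V, k^o)) :=
  (linfun (res_functional B V) \o daddv_pi P V)%VF.

Definition decomp : 'Hom(A, dext (redv B J) (subvs_of V)) :=
  linfun (fun a => (part_compl a, part_red a, part_dual a)).

Lemma decompE a : decomp a = (part_compl a, part_red a, part_dual a).
Proof. by rewrite linfun_linearE // => c x y; rewrite !linearP. Qed.

Let pi_P p : p \in P -> daddv_pi V P p = 0 /\ daddv_pi P V p = p.
Proof.
move=> Pp; have E := daddv_pi_id PV0 Pp; split=> //.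
have := daddv_pi_add VP0 (_ : p \in (V + P)%VS).
by rewrite addvC PVf memvf E => /(_ isT)/(canRL (addrK _)) ->; rewrite subrr.
Qed.

Let pi_V v : v \in V -> daddv_pi V P v = v /\ daddv_pi P V v = 0.
Proof.
move=> Vv; have E := daddv_pi_id VP0 Vv; split=> //.
have := daddv_pi_add VP0 (_ : v \in (V + P)%VS).
by rewrite addvC PVf memvf E => /(_ isT)/(canRL (addKr _)) ->; rewrite addNr.
Qed.

Lemma part_complP p : p \in P -> part_compl p = 0.
Proof.
by move=> /pi_P[E _]; rewrite /part_compl comp_lfunE E linear0.
Qed.

Lemma part_redP p : p \in P -> part_red p = red_pi (vsproj P p).
Proof.
by move=> /pi_P[_ E]; rewrite /part_red !comp_lfunE E !lfunE.
Qed.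

Lemma part_redJ j : j \in J -> part_red j = 0.
Proof.
move=> Jj; have Pj := subvP JP _ Jj; rewrite part_redP //.
have <- : red_pi (0 : subvs_of P) = 0 :> redv B J by exact: linear0.
by apply/eqP; rewrite red_pi_eq /= subr0 vsprojK.
Qed.

Lemma part_dualP p : p \in P -> part_dual p = res_functional B V p.
Proof.
by move=> /pi_P[_ E]; rewrite comp_lfunE E; exact: lfunE.
Qed.

Lemma part_complV (x : subvs_of V) : part_compl (vsval x) = x.
Proof.
have [E _] := pi_V (subvsP x).
by rewrite /part_compl comp_lfunE E lfunE /= vsvalK.
Qed.

Lemma decompD (x : subvs_of V) p : p \in P ->
  decomp (vsval x + p) = (x, red_pi (vsproj P p), res_functional B V p).
Proof.
move=> Pp; have [Ex1 Ex2] := pi_V (subvsP x); have [Ep1 Ep2] := pi_P Pp.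
rewrite decompE /part_compl /part_red /part_dual !comp_lfunE.
have -> : daddv_pi V P (vsval x + p) = vsval x.
  by rewrite raddfD /= Ex1 Ep1 addr0.
have -> : daddv_pi P V (vsval x + p) = p.
  by rewrite raddfD /= Ex2 Ep2 add0r.
congr (_, _, _); last exact: lfunE.
  by rewrite lfunE /= vsvalK.
by rewrite [linfun (vsproj P) p]lfunE; exact: lfunE.
Qed.

Lemma part_decomp a :
  exists x : subvs_of V, exists2 p, p \in P & a = vsval x + p.
Proof.
exists (vsproj V (daddv_pi V P a)), (daddv_pi P V a); first exact: memv_pi.
rewrite vsprojK ?memv_pi //.
by rewrite daddv_pi_add // addvC PVf memvf.
Qed.

Lemma decomp_isometry :
  isometry (dext_form (red_form B J) (res_form B V)) B decomp.
Proof.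
move=> a b; have [x [p Pp ->]] := part_decomp a.
have [y [q Pq ->]] := part_decomp b.
rewrite !decompD // -[LHS]/(B (vsval x) (vsval y)
  + red_form B J (red_pi (vsproj P p)) (red_pi (vsproj P q))
  + res_functional B V p y + res_functional B V q x).
rewrite red_formE !res_functionalE !vsprojK //.
rewrite linearDl !linearDr /= [B (vsval x) q]symmetric_formC.
by rewrite addrAC -!addrA; congr (_ + _); rewrite addrC -addrA.
Qed.

Lemma lker_decomp : lker decomp == 0%VS.
Proof.
apply/lker0P => a b E.
have inj c : decomp c = 0 -> c = 0.
  move=> Ec; apply: (nondegenerateP _ ndB) => y.
  by rewrite -decomp_isometry Ec linear0l.
by apply/eqP; rewrite -subr_eq0; apply/eqP/inj; rewrite linearB /= E subrr.
Qed.

Lemma decomp_onto X : exists a, decomp a = X.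
Proof.
case: X => [[x w] h].
pose p := vsval (red_repr w); have Pp : p \in P by exact: subvsP.
(* J maps injectively to V^*, hence onto it by equality of dimensions. A representative of w can
   thus be corrected by an element of J, which leaves its class unchanged, to induce the prescribed
   functional h on V. *)
have ontoJ : (linfun (res_functional B V) @: J)%VS = fullv.
  apply/eqP; rewrite eqEdim subvf /= dim_dual -dim_isotropic_compl.
  by rewrite limg_dim_eq // lker_res_functional cap_isotropic_orthov.
have := memvf (h - res_functional B V p).
rewrite -ontoJ => /memv_imgP[j Jj Ej].
have {}Ej : res_functional B V j = h - res_functional B V p.
  by rewrite Ej [RHS]lfunE.
have Ppj := memvD Pp (subvP JP _ Jj).
exists (vsval x + (p + j)); rewrite decompD //; congr (_, _, _).
  rewrite -[RHS]red_reprK; apply/eqP.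
  by rewrite red_pi_eq vsprojK // addrC addKr.
have -> := raddfD (res_functional B V) p j; rewrite /= Ej; exact: subrKC.
Qed.

Lemma decomp_bij : bijective decomp.
Proof.
exists (decomp^-1)%VF; first exact/lker0_lfunK/lker_decomp.
by move=> X; have [a <-] := decomp_onto X; rewrite lker0_lfunK ?lker_decomp.
Qed.

(** * The product in coordinates *)

Definition emb_compl : 'Hom(subvs_of V, A) := linfun vsval.

(** The lift of W into S^⊥: its values lie in J^⊥ and induce the zero functional on V. *)
Definition emb_red : 'Hom(redv B J, A) :=
  (decomp^-1 \o linfun (fun w => (0, w, 0) : dext _ _))%VF.

Definition emb_dual : 'Hom('Hom(subvs_of V, k^o), A) :=
  (decomp^-1 \o linfun (fun h => (0, 0, h) : dext _ _))%VF.

Let decompVK X : decomp (decomp^-1 X)%VF = X.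
Proof. by have [a <-] := decomp_onto X; rewrite lker0_lfunK ?lker_decomp. Qed.

Lemma emb_redK w : decomp (emb_red w) = (0, w, 0).
Proof.
rewrite /emb_red comp_lfunE decompVK linfun_linearE // => c u v.
by congr (_, _, _); rewrite /= ?scaler0 ?addr0.
Qed.

Lemma emb_dualK h : decomp (emb_dual h) = (0, 0, h).
Proof.
rewrite /emb_dual comp_lfunE decompVK linfun_linearE // => c u v.
by congr (_, _, _); rewrite /= ?scaler0 ?addr0.
Qed.

Let part_compl0P a : part_compl a = 0 -> a \in P.
Proof.
have [x [p Pp Ea]] := part_decomp a.
move=> a0; have := decompE a; rewrite a0 Ea decompD // => -[-> _ _].
by rewrite linear0 add0r.
Qed.

Lemma emb_red_orthov w : emb_red w \in P.
Proof. by apply: part_compl0P; have := emb_redK w; rewrite decompE => -[]. Qed.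

Lemma emb_dual_ideal h : emb_dual h \in J.
Proof.
have := emb_dualK h; rewrite decompE => -[/part_compl0P Pj + _].
rewrite part_redP //.
have <- : red_pi (0 : subvs_of P) = 0 :> redv B J by exact: linear0.
by move/eqP; rewrite red_pi_eq /= subr0 vsprojK.
Qed.

Lemma decompK a :
  emb_compl (part_compl a) + emb_red (part_red a) + emb_dual (part_dual a) = a.
Proof.
apply: (lker0P lker_decomp).
rewrite !linearD /= emb_redK emb_dualK [emb_compl _]lfunE /=.
rewrite -[vsval _]addr0 decompD ?mem0v //.
by rewrite decompE; congr (_, _, _); rewrite /= ?raddf0 ?add0r ?addr0.
Qed.

(** This is the product of A/J^⊥ carried to V, since J^⊥ is an ideal complementary to V. *)
Definition ext_mul : {bilinear subvs_of V -> subvs_of V -> subvs_of V} :=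
  bilinear_comp mul part_compl emb_compl emb_compl.

Definition ext_data : dext_data (redv B J) (subvs_of V) := {|
  dext_mu := hom_of_bilinearl (bilinear_comp mul part_red emb_compl emb_red);
  dext_mu' := hom_of_bilinearr (bilinear_comp mul part_red emb_red emb_compl);
  dext_phi := bilinear_comp mul part_dual emb_red emb_red;
  dext_v := bilinear_comp mul part_dual emb_compl emb_red;
  dext_v' := bilinear_comp mul part_dual emb_red emb_compl;
  dext_lambda := bilinear_comp mul part_red emb_compl emb_compl;
  dext_gamma := bilinear_comp mul part_dual emb_compl emb_compl |}.

(** [emb_dual h] lies in J, so it is orthogonal to J^⊥ and sees only the V-component of a. *)
Lemma form_emb_dual h a : B (emb_dual h) a = h (part_compl a).
Proof.
have Jj := emb_dual_ideal h; have [x [p Pp ->]] := part_decomp a.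
have /mem_orthovP/(_ _ Jj) Bp := Pp.
rewrite linearDr /= [B _ p]symmetric_formC Bp addr0 linearD /= part_complV.
rewrite part_complP // addr0 -res_functionalE -part_dualP ?(subvP JP) //.
by have := emb_dualK h; rewrite decompE => -[_ _ ->].
Qed.

Lemma part_dual_mull x h :
  part_dual (mul (emb_compl x) (emb_dual h)) = dualLstar ext_mul x h.
Proof.
have [_ _ inv] := AB; have Jj := emb_dual_ideal h.
apply/lfunP => z; rewrite dualLstarE part_dualP; last first.
  by apply: (subvP JP); case: (idJ (emb_compl x) Jj).
rewrite res_functionalE inv form_emb_dual /star linearD.
by congr (- h (_ (mul _ _) + _ (mul _ _))); rewrite [emb_compl _]lfunE.
Qed.

Lemma part_dual_mulr x h :
  part_dual (mul (emb_dual h) (emb_compl x)) = - dualR ext_mul x h.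
Proof.
have Jj := emb_dual_ideal h.
apply/lfunP => z; rewrite opp_lfunE dualRE opprK part_dualP; last first.
  by apply: (subvP JP); case: (idJ (emb_compl x) Jj).
rewrite res_functionalE (form_mulC AB) symmetric_formC form_emb_dual.
by congr (h (_ (mul _ _))); rewrite [emb_compl _]lfunE.
Qed.

Lemma part_red_mul w v :
  part_red (mul (emb_red w) (emb_red v)) = red_mul AB idJ w v.
Proof.
have Pw := emb_red_orthov w; have Pv := emb_red_orthov v.
have redK u : red_pi (vsproj P (emb_red u)) = u.
  rewrite -part_redP ?emb_red_orthov //.
  by have := emb_redK u; rewrite decompE => -[].
rewrite -[in RHS](redK w) -[in RHS](redK v).
have [Pwv _] := ideal_orthov AB idJ (emb_red v) Pw.
rewrite part_redP //; apply/esym/red_mulE; rewrite !vsprojK //.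
Qed.

Lemma decomp_mul a b : decomp (mul a b)
  = dext_mul (red_mul AB idJ) ext_mul ext_data (decomp a) (decomp b).
Proof.
rewrite -[in LHS](decompK a) -[in LHS](decompK b) !decompE.
move: (part_compl a) (part_red a) (part_dual a) => x w h.
move: (part_compl b) (part_red b) (part_dual b) => y v g.
have idP := ideal_orthov AB idJ.
have Pp := emb_red_orthov w; have Pq := emb_red_orthov v.
have Ji := emb_dual_ideal h; have Jj := emb_dual_ideal g.
have Pi := subvP JP _ Ji.
set m := mul _ _.
(* Of the nine products, S^⊥·J, J·S^⊥ and J·J vanish, the last because isotropy puts J inside
   J^⊥. *)
have {m} -> : m = mul (emb_compl x) (emb_compl y) + mul (emb_red w) (emb_red v)
    + mul (emb_compl x) (emb_red v) + mul (emb_compl x) (emb_dual g)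
    + mul (emb_red w) (emb_compl y) + mul (emb_dual h) (emb_compl y).
  have [pj0 _] := mul_orthov_ideal AB idJ Pp Jj.
  have [_ iq0] := mul_orthov_ideal AB idJ Pq Ji.
  have [ij0 _] := mul_orthov_ideal AB idJ Pi Jj.
  rewrite /m !linearDl !linearDr /= pj0 iq0 ij0 !addr0.
  by rewrite [LHS](AC (3*2*1) (1*5*2*3*4*6)).
have [Ppq _] := idP _ (emb_red v) Pp.
have [_ Pxq] := idP _ (emb_compl x) Pq.
have [Ppy _] := idP _ (emb_compl y) Pp.
have [_ Jxj] := idJ (emb_compl x) Jj.
have [Jiy _] := idJ (emb_compl y) Ji.
congr (_, _, _).
- rewrite !raddfD /= (part_complP Ppq) (part_complP Pxq) (part_complP Ppy).
  rewrite (part_complP (subvP JP _ Jxj)) (part_complP (subvP JP _ Jiy)).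
  by rewrite !addr0.
- rewrite !raddfD /= (part_redJ Jxj) (part_redJ Jiy) !addr0.
  rewrite part_red_mul; congr (_ + _ + _ + _) => //.
    exact/esym/hom_of_bilinearlE.
  exact/esym/hom_of_bilinearrE.
by rewrite !raddfD /= part_dual_mull part_dual_mulr.
Qed.

End Decomposition.

(** * Assembling the double extension *)

(** The projection of the extension onto [A2] is multiplicative and surjective, so the Novikov
    identities descend. *)
Lemma novikov_dext_base (k : fieldType) (A1 A2 : vectType k)
    (mul1 : {bilinear A1 -> A1 -> A1}) (mul2 : {bilinear A2 -> A2 -> A2})
    (D : dext_data A1 A2) :
  novikov (dext_mul mul1 mul2 D) -> novikov mul2.
Proof.
pose i (x : A2) : dext A1 A2 := (x, 0, 0).
case=> ls rc; split=> a b c.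
  exact: (congr1 (fun X => X.1.1) (ls (i a) (i b) (i c))).
exact: (congr1 (fun X => X.1.1) (rc (i a) (i b) (i c))).
Qed.

Theorem theorem4p13 (k : fieldType) (char0 : [pchar k] =i pred0)
    (A : vectType k) (mul : {bilinear A -> A -> A}) (B : {symmetric A})
    (AB : quadratic_novikov mul B)
    (J : {vspace A}) (J0 : J != 0%VS)
    (idJ : ideal mul J) (isoJ : isotropic B J)
    (V : {vspace A})
    (JV_dir : directv (orthov B J + V)) (JV_full : (orthov B J + V)%VS = fullv) :
  let S := (J + V)%VS in
  let mulW := red_mul AB idJ in
  let BW := red_form B J in
  let tau : {symmetric subvs_of V} := res_form B V in
  [/\ directv (J + V),
      directv (V + orthov B S + J),
      (V + orthov B S + J)%VS = fullv
    & exists (mulV : {bilinear subvs_of V -> subvs_of V -> subvs_of V})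
             (D : dext_data (redv B J) (subvs_of V)),
        double_extension mulW BW mulV tau D
        /\ quadratic_novikov_iso mul B
             (dext_mul mulW mulV D) (dext_form BW tau)].
Proof.
move=> S mulW BW tau.
have PV0 := directv_addP JV_dir.
split.
- exact: (directv_isotropic_compl isoJ).
- exact: (directv_hyperbolic AB).
- exact: (addv_hyperbolic AB).
pose mulV := ext_mul mul B J V.
pose D := ext_data mul B J V.
have iso :
    quadratic_novikov_iso mul B (dext_mul mulW mulV D) (dext_form BW tau).
  exists (decomp B J V); split.
  - exact: (decomp_bij AB).
  - exact: decomp_mul.
  - exact: decomp_isometry.
have qD := quadratic_novikov_transport iso AB.
exists mulV, D; split=> //; split=> //.
  exact: quadratic_novikov_red.
by case: qD => /novikov_dext_base.
Qed.
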